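(* Let $\varepsilon\in\{0,\tfrac12\}$ and let $\mathcal{SV}(\varepsilon)$ be the Schrödinger–Virasoro Lie algebra. A bilinear map $f:\mathcal{SV}(\varepsilon)\times\mathcal{SV}(\varepsilon)\to\mathcal{SV}(\varepsilon)$ is a biderivation of $\mathcal{SV}(\varepsilon)$ if and only if there exist $\lambda\in\mathbb{C}$ and a family $\Omega=\{\mu_i\in\mathbb{C}\mid i\in\mathbb{Z}\}$ with only finitely many nonzero $\mu_i$ such that $$f(x,y)=\lambda[x,y]+\chi_\Omega(x,y)\quad\text{for all }x,y\in\mathcal{SV}(\varepsilon).$$
   Context: For $\varepsilon\in\{0,\frac12\}$, $\mathcal{SV}(\varepsilon)$ is the complex Lie algebra with basis $\{L_i,Y_j,M_i\mid i\in\mathbb{Z},\ j\in\varepsilon+\mathbb{Z}\}$ and brackets $[L_m,L_n]=(m-n)L_{m+n}$, $[L_m,Y_n]=(\frac12 m-n)Y_{m+n}$, $[L_m,M_n]=-nM_{m+n}$, $[Y_m,Y_n]=(m-n)M_{m+n}$, $[Y_m,M_n]=[M_m,M_n]=0$. Write $\mathfrak{Y}=\bigoplus_{j\in\varepsilon+\mathbb{Z}}\mathbb{C}Y_j$ and $\mathfrak{M}=\bigoplus_{i\in\mathbb{Z}}\mathbb{C}M_i$. A biderivation of a Lie algebra $L$ is a bilinear map $f:L\times L\to L$ with $f([x,y],z)=[x,f(y,z)]+[f(x,z),y]$ and $f(x,[y,z])=[f(x,y),z]+[y,f(x,z)]$ for all $x,y,z\in L$. For a family $\Omega=\{\mu_i\}_{i\in\mathbb{Z}}$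 with finitely many nonzero entries, $\chi_\Omega$ is the bilinear map on $\mathcal{SV}(\varepsilon)$ defined by $\chi_\Omega(L_m,L_n)=\sum_{i\in\mathbb{Z}}\mu_iM_{m+n+i}$ for all $m,n\in\mathbb{Z}$, and $\chi_\Omega(x,y)=0$ whenever $x$ or $y$ is a basis element lying in $\mathfrak{Y}\cup\mathfrak{M}$. *)

(* Defs.v *)
From HB Require Import structures.
From mathcomp Require Import all_boot all_order all_algebra.
From mathcomp Require Import finmap.
From mathcomp Require Import complex.
From mathcomp Require Import Rstruct.
From mathcomp Require monalg.
Import monalg.
Set Implicit Arguments. Unset Strict Implicit. Unset Printing Implicit Defensive.
Import Order.TTheory GRing.Theory Num.Theory.
Local Open Scope ring_scope.

Definition CC : Type := complex Rdefinitions.R.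

(* Index set of the basis {L_i, Y_j, M_i}.  [BY k] stands for Y_(k + eps),
   so that k ranges over Z while j = k + eps ranges over eps + Z. *)
Inductive SVbasis := BL of int | BY of int | BM of int.

Definition SVbasis_code (b : SVbasis) : (int + int) + int :=
  match b with BL m => inl (inl m) | BY k => inl (inr k) | BM n => inr n end.
Definition SVbasis_decode (c : (int + int) + int) : SVbasis :=
  match c with inl (inl m) => BL m | inl (inr k) => BY k | inr n => BM n end.
Lemma SVbasis_codeK : cancel SVbasis_code SVbasis_decode.
Proof. by case. Qed.
HB.instance Definition _ := Countable.copy SVbasis (can_type SVbasis_codeK).

Definition SV : Type := {malg CC[SVbasis]}.

Definition vL (m : int) : SV := << BL m >>.
Definition vY (k : int) : SV := << BY k >>.   (* Y_(k + eps) *)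
Definition vM (n : int) : SV := << BM n >>.

Definition epsC (e : bool) : CC := if e then 2^-1 else 0.
(* 2 * eps, an integer *)
Definition eps2 (e : bool) : int := if e then 1 else 0.

(* [L_m, Y_(k+eps)] = (m/2 - (k+eps)) Y_(m+k+eps) *)
Definition cLY (e : bool) (m k : int) : CC := m%:~R / 2 - (k%:~R + epsC e).

Definition SVbr (e : bool) (a b : SVbasis) : SV :=
  match a, b with
  | BL m, BL n => (m - n)%:~R *: vL (m + n)
  | BL m, BY k => cLY e m k *: vY (m + k)
  | BY k, BL m => - cLY e m k *: vY (m + k)
  | BL m, BM n => (- n)%:~R *: vM (m + n)
  | BM n, BL m => n%:~R *: vM (m + n)
  | BY k1, BY k2 => (k1 - k2)%:~R *: vM (k1 + k2 + eps2 e)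
      (* [Y_(k1+eps), Y_(k2+eps)] = (k1 - k2) M_(k1+k2+2eps) *)
  | _, _ => 0
  end.

Definition bilin_ext (g : SVbasis -> SVbasis -> SV) (x y : SV) : SV :=
  \sum_(a <- msupp x) \sum_(b <- msupp y) (x@_a * y@_b) *: g a b.

Definition SVbracket (e : bool) : SV -> SV -> SV := bilin_ext (SVbr e).

(* chi_Omega, for a finitely supported family Omega = (mu_i)_(i in Z),
   given as an element of {malg CC[int]} (mu_i = Omega@_i). *)
Definition chi_basis (Om : {malg CC[int]}) (a b : SVbasis) : SV :=
  match a, b with
  | BL m, BL n => \sum_(i <- msupp Om) Om@_i *: vM (m + n + i)
  | _, _ => 0
  end.
Definition chi (Om : {malg CC[int]}) : SV -> SV -> SV := bilin_ext (chi_basis Om).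

Definition is_bilinear (f : SV -> SV -> SV) : Prop :=
  (forall (c : CC) (x y z : SV), f (c *: x + y) z = c *: f x z + f y z) /\
  (forall (c : CC) (x y z : SV), f z (c *: x + y) = c *: f z x + f z y).

Definition is_biderivation (e : bool) (f : SV -> SV -> SV) : Prop :=
  (forall x y z : SV,
     f (SVbracket e x y) z = SVbracket e x (f y z) + SVbracket e (f x z) y) /\
  (forall x y z : SV,
     f x (SVbracket e y z) = SVbracket e (f x y) z + SVbracket e y (f x z)).

(* Main.v *)
(* Bracketing with L_0 measures degrees: [L_0, v] = - deg(v) v.  Taking L_0 as
   one of the arguments in the two derivation identities determines each
   coordinate of f(L_p, L_q) from f(L_0, L_q), f(L_p, L_0) and f(L_0, L_0), and
   comparing the two resulting expressions leaves only lambda [L_p, L_q] and,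
   in the M-coordinates, a constant for each degree shift: this is chi.
   After subtraction f vanishes on pairs of L's.  Then f(L_n, x) is homogeneous of
   the degree of x whatever n is, and f(x, y) is homogeneous both of the degree
   of x and of that of y; the derivation identities against the L_m,
   which shift degrees, force all these values to be zero. *)
Require Import Defs.
From HB Require Import structures.
From mathcomp Require Import all_boot all_order all_algebra.
From mathcomp Require Import finmap complex Rstruct.
From mathcomp Require Import ring zify.
From mathcomp Require monalg.
Import monalg.
Import Order.TTheory GRing.Theory Num.Theory.
Local Open Scope ring_scope.

(** * Two-argument cocycles: constancy for s = 0, vanishing for nonzero degree *)

Section WittCocycle.
Local Set Implicit Arguments.
Local Unset Strict Implicit.

(* For c a basis index of degree d and f a biderivation, the functions
   h p q = (coordinate of f(L_p, L_q) at c shifted by p + q) satisfy this in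
   each argument, where s is 1, 1/2 or 0 according to whether c is in L, Y or M. *)
Definition witt_cocycle (K : numFieldType) (s d : K) (h : int -> int -> K) : Prop :=
  forall m p n : int,
    (m%:~R - p%:~R) * h (m + p) n
    = (s * m%:~R - (p%:~R + n%:~R + d)) * h p n
      - (s * p%:~R - (m%:~R + n%:~R + d)) * h m n.

Context (K : numFieldType).
Implicit Types (s d : K) (h : int -> int -> K) (m n p q : int).

Lemma cadd (a b c d : K) : a = b -> c = d -> a + c = b + d.
Proof. by move=> -> ->. Qed.

Lemma cmul (c a b : K) : a = b -> c * a = c * b.
Proof. by move=> ->. Qed.

Lemma lincomb (a b c d : K) : a = b -> c - d = a - b -> c = d.
Proof. by move=> -> /eqP; rewrite subrr subr_eq0 => /eqP. Qed.

(** The case m = 0 of the identity, that is, bracketing with L_0. It recovers [h p n] from [h 0 n]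
    except on the line n + d = 0. *)
Lemma witt_cocycle_0 s d h p n : witt_cocycle s d h ->
  (n%:~R + d) * h p n = (n%:~R + d - s * p%:~R) * h 0 n.
Proof. move=> H; have := H 0 p n; rewrite (add0r p) => E; apply: (lincomb E); ring. Qed.

(** The case m = 2q, p = -q, n = q. It reaches the point (q, q) with q = -d, where the L_0 relations
    in both arguments degenerate, from first arguments -q and 2q, where they do not if q is
    nonzero. *)
Lemma witt_cocycle_diag s d h q : witt_cocycle s d h ->
  3%:R * q%:~R * h q q
  = (s * 2%:R * q%:~R - d) * h (- q) q + (s * q%:~R + 3%:R * q%:~R + d) * h (2 * q) q.
Proof.
move=> H; have := H (2 * q) (- q) q.
rewrite (_ : 2 * q + - q = q); last by ring.
by rewrite !intrM !intrN => E; apply: (lincomb E); ring.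
Qed.

Context (h : int -> int -> K).
Let h' p q := h q p.

(** For s = 0 the L_0 relation reads (n + d)(h p n - h 0 n) = 0, and likewise in the other argument,
    so [h] is constant away from the exceptional lines p = -d and q = -d. For d = 0 these are the
    axes; for d nonzero only their crossing point needs more work. *)
Lemma witt_bicocycle_const d p q :
  witt_cocycle 0 d h -> witt_cocycle 0 d h' -> h p q = h 0 0.
Proof.
move=> H H'.
have E1 p1 q1 : q1%:~R + d != 0 -> h p1 q1 = h 0 q1.
  move=> nz; apply: (mulfI nz); rewrite (witt_cocycle_0 p1 q1 H); ring.
have E2 p1 q1 : p1%:~R + d != 0 -> h p1 q1 = h p1 0.
  move=> nz; apply: (mulfI nz); rewrite (witt_cocycle_0 q1 p1 H') /h'; ring.
have [d0|d0] := eqVneq d 0.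
  have F1 p1 q1 : q1 != 0 -> h p1 q1 = h 0 q1.
    by move=> nz; apply: E1; rewrite d0 addr0 intr_eq0.
  have F2 p1 q1 : p1 != 0 -> h p1 q1 = h p1 0.
    by move=> nz; apply: E2; rewrite d0 addr0 intr_eq0.
  have G1 q1 : q1 != 0 -> h 0 q1 = h 1 0.
    by move=> nz; rewrite -(F1 1 q1 nz) F2.
  have G2 p1 : p1 != 0 -> h p1 0 = h 1 0.
    by move=> nz; rewrite -(F2 p1 1 nz) F1 // G1.
  have G0 : h 0 0 = h 1 0.
    (* The origin escapes both relations; the brackets of L_1 and L_(-1) make [h 0 0] the mean of
       [h 1 0] and [h (-1) 0]. *)
    have := H 1 (-1) 0; rewrite subrr (G2 (-1) isT) d0 intrN => E.
    by apply: (@mulfI _ 2%:R); rewrite ?pnatr_eq0 //; apply: (lincomb E); ring.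
  have [->|p0] := eqVneq p 0; have [->|q0] := eqVneq q 0 => //.
  - by rewrite G1.
  - by rewrite G2.
  - by rewrite F1 // G1.
have Z1 q1 : h 0 q1 = h 0 0 by rewrite E2 // add0r.
have Z2 p1 : h p1 0 = h 0 0 by rewrite E1 // add0r.
(* Both relations fail only at p = q = -d, which [witt_cocycle_diag] settles. *)
have [q0|q0] := eqVneq (q%:~R + d) 0; last by rewrite E1.
have [p0|p0] := eqVneq (p%:~R + d) 0; last by rewrite E2.
have dq : d = - q%:~R by apply: (lincomb q0); ring.
have pq : p = q.
  by apply: (@intr_inj K); apply: (lincomb (cadd p0 (cmul (-1) q0))); ring.
have qn0 : q%:~R != 0 :> K by move: d0; rewrite dq oppr_eq0.
rewrite pq; have := witt_cocycle_diag q H.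
rewrite (E2 (- q)) ?(E2 (2 * q)) ?Z2; first last.
- rewrite dq intrN -opprD oppr_eq0 -mulr2n mulrn_eq0 //.
- by rewrite dq intrM (_ : _ - _ = q%:~R) //; ring.
rewrite dq => E; apply: (@mulfI _ (3%:R * q%:~R)); first by rewrite mulf_neq0 ?pnatr_eq0.
by apply: (lincomb E); ring.
Qed.

(** The integer [r] is the zero of the factor d - s p in the L_0 relation at n = 0. It forces
    [h 0 0 = 0], after which both axes and then all other points vanish, with the diagonal exception
    treated as for s = 0. *)
Lemma witt_bicocycle_vanish s d r p q :
  0 < s -> s * r%:~R = d -> d != 0 ->
  witt_cocycle s d h -> witt_cocycle s d h' -> h p q = 0.
Proof.
move=> s0 rd d0 H H'.
have r0 : r%:~R != 0 :> K by apply: contraNneq d0 => r0; rewrite -rd r0 mulr0.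
have h00 : h 0 0 = 0.
  (* With d = s r, [A3] gives [h r 0 = 0]; then [A2] gives [h r (- r) = 0] since r + d = (1 + s) r
     is nonzero; then [A1] gives [h 0 (- r) = 0], and [A4] reads d h 0 (-r) = 2 d h 0 0. The linear
     combination below performs this elimination at once. *)
  have A1 := witt_cocycle_0 r (- r) H.
  have A2 := witt_cocycle_0 (- r) r H'.
  have A3 := witt_cocycle_0 r 0 H.
  have A4 := witt_cocycle_0 (- r) 0 H'.
  rewrite /h' in A1 A2 A3 A4.
  have nz : (1 + s) * r%:~R * r%:~R * (2%:R * d) != 0.
    by rewrite !mulf_neq0 // ?pnatr_eq0 // gt_eqF // addr_gt0.
  apply: (mulfI nz); rewrite mulr0.
  move: A1 A2 A3 A4; rewrite !intrN -rd mulr0z.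
  set R := r%:~R; set S := s * R => A1 A2 A3 A4.
  apply: (lincomb (cadd (cadd (cmul ((R + S) * S) A1) (cmul (- ((S - R) * S)) A2))
    (cadd (cmul ((R + S) * (S - R - S)) A4) (cmul (- ((S - R) * (R + S + S))) A3)))).
  rewrite /S; ring.
have Z1 q1 : h 0 q1 = 0.
  apply: (mulfI d0); have := witt_cocycle_0 q1 0 H'.
  by rewrite /h' h00 !mulr0 add0r.
have Z2 p1 : h p1 0 = 0.
  apply: (mulfI d0); have := witt_cocycle_0 p1 0 H.
  by rewrite h00 !mulr0 add0r.
have E1 p1 q1 : q1%:~R + d != 0 -> h p1 q1 = 0.
  by move=> nz; apply: (mulfI nz); rewrite (witt_cocycle_0 p1 q1 H) Z1 !mulr0.
have E2 p1 q1 : p1%:~R + d != 0 -> h p1 q1 = 0.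
  move=> nz; apply: (mulfI nz); rewrite (witt_cocycle_0 q1 p1 H') /h' Z2.
  by rewrite !mulr0.
have [q0|q0] := eqVneq (q%:~R + d) 0; last by rewrite E1.
have [p0|p0] := eqVneq (p%:~R + d) 0; last by rewrite E2.
have dq : d = - q%:~R by apply: (lincomb q0); ring.
have pq : p = q by apply: (@intr_inj K); apply: (lincomb (cadd p0 (cmul (-1) q0))); ring.
have qn0 : q%:~R != 0 :> K by move: d0; rewrite dq oppr_eq0.
rewrite pq; have := witt_cocycle_diag q H.
rewrite (E2 (- q)) ?(E2 (2 * q)); first last.
- rewrite dq intrN -opprD oppr_eq0 -mulr2n mulrn_eq0 //.
- by rewrite dq intrM (_ : _ - _ = q%:~R) //; ring.
rewrite !mulr0 addr0 => E; apply: (@mulfI _ (3%:R * q%:~R)).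
  by rewrite mulf_neq0 ?pnatr_eq0.
by rewrite E mulr0.
Qed.

End WittCocycle.

(** * Cocycles of degree zero with s = 1/2 and s = 1 *)

Section WittCocycleDeg0.
Local Set Implicit Arguments.
Local Unset Strict Implicit.
Context (K : numFieldType).
Implicit Types (h : int -> int -> K) (p q : int).

Lemma witt_bicocycle_half_0 h q :
  witt_cocycle 2^-1 0 h -> witt_cocycle 2^-1 0 (fun p q => h q p) -> h 0 q = 0.
Proof.
move=> H H'.
have E1 p1 q1 : q1%:~R * h p1 q1 = (q1%:~R - 2^-1 * p1%:~R) * h 0 q1.
  by have := witt_cocycle_0 p1 q1 H; rewrite addr0.
have E2 p1 q1 : p1%:~R * h p1 q1 = (p1%:~R - 2^-1 * q1%:~R) * h p1 0.
  by have := witt_cocycle_0 q1 p1 H'; rewrite addr0.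
have [->|q0] := eqVneq q 0.
  have := E1 1 0; rewrite mulr0z mulr1z => E.
  apply: (@mulfI _ (2^-1)); first by rewrite invr_eq0 pnatr_eq0.
  by apply: (lincomb E); ring.
have qK : q%:~R != 0 :> K by rewrite intr_eq0.
(* The factor q - p/2 in [E1] vanishes at p = 2q. Starting from such a zero, the chain (4q, 2q),
   (4q, 0), (4q, q), (0, q) alternates between the two arguments. *)
have A1 := E1 (4 * q) (2 * q); have A2 := E2 (4 * q) (2 * q).
have A3 := E1 (4 * q) q; have A4 := E2 (4 * q) q.
rewrite !intrM in A1 A2 A3 A4.
have B1 : h (4 * q) (2 * q) = 0.
  by apply: (mulfI qK); apply: (lincomb (cmul 2^-1 A1)); field.
have B2 : h (4 * q) 0 = 0.
  by apply: (mulfI qK); apply: (lincomb (cmul (- 3%:R^-1) A2)); rewrite B1; field.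
have B3 : h (4 * q) q = 0.
  by apply: (mulfI qK); apply: (lincomb (cmul (4%:R^-1) A4)); rewrite B2; field.
by apply: (mulfI qK); apply: (lincomb A3); rewrite B3; field; rewrite ?pnatr_eq0.
Qed.

Lemma witt_bicocycle_half h p q :
  witt_cocycle 2^-1 0 h -> witt_cocycle 2^-1 0 (fun p q => h q p) -> h p q = 0.
Proof.
move=> H H'.
have [->|q0] := eqVneq q 0; first exact: (@witt_bicocycle_half_0 (fun p q => h q p) p H' H).
apply: (@mulfI _ q%:~R); first by rewrite intr_eq0.
have := witt_cocycle_0 p q H; rewrite (witt_bicocycle_half_0 q H H') addr0 !mulr0 => ->.
by [].
Qed.

(** This is the case that produces the inner part: [h 1 0] will be lambda. Computing p q h p q by
    both L_0 relations and cancelling p - q shows that [h p 0] and [h 0 q] are proportional to p and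
    -q. *)
Lemma witt_bicocycle_one h p q :
  witt_cocycle 1 0 h -> witt_cocycle 1 0 (fun p q => h q p) ->
  h p q = (p%:~R - q%:~R) * h 1 0.
Proof.
move=> H H'.
have E1 p1 q1 : q1%:~R * h p1 q1 = (q1%:~R - p1%:~R) * h 0 q1.
  by have := witt_cocycle_0 p1 q1 H; rewrite addr0 mul1r.
have E2 p1 q1 : p1%:~R * h p1 q1 = (p1%:~R - q1%:~R) * h p1 0.
  by have := witt_cocycle_0 q1 p1 H'; rewrite addr0 mul1r.
have h00 : h 0 0 = 0.
  by have := E1 1 0; rewrite mulr0z mulr1z => E; apply: (lincomb E); ring.
have F p1 q1 : p1 != q1 -> q1%:~R * h p1 0 = - (p1%:~R * h 0 q1).
  move=> pq; have nz : p1%:~R - q1%:~R != 0 :> K by rewrite subr_eq0 eqr_int.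
  apply: (mulfI nz).
  by apply: (lincomb (cadd (cmul p1%:~R (E1 p1 q1)) (cmul (- q1%:~R) (E2 p1 q1)))); ring.
have G q1 : h 0 q1 = - (q1%:~R * h 1 0).
  have [->|q1n] := eqVneq q1 1.
    (* [F] excludes the pair (1, 1), so [h 0 1] is tied to [h 1 0] by the detour through (1, 3), (2,
       3) and (2, 1). *)
    have A1 := F 1 3 isT; have A2 := F 2 3 isT; have A3 := F 2 1 isT.
    apply: (@mulfI _ 6%:R); first by rewrite pnatr_eq0.
    apply: (lincomb (cadd (cmul 2%:R A1) (cadd (cmul (-1) A2) (cmul 3%:R A3)))).
    by ring.
  by have := F 1 q1; rewrite eq_sym mulr1z mul1r => ->; rewrite ?opprK.
have G' p1 : h p1 0 = p1%:~R * h 1 0.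
  have [->|p0] := eqVneq p1 0; first by rewrite h00 mulr0z mul0r.
  have := F p1 (2 * p1); rewrite G intrM => E.
  have nz : 2%:~R * p1%:~R != 0 :> K by rewrite mulf_neq0 ?intr_eq0.
  apply: (mulfI nz); rewrite E; first by ring.
  lia.
have [->|q0] := eqVneq q 0; first by rewrite G' subr0.
apply: (@mulfI _ q%:~R); first by rewrite intr_eq0.
by rewrite E1 G; ring.
Qed.
End WittCocycleDeg0.

(** * Bilinear maps and biderivations of an arbitrary bilinear product *)

Section Bilinear.
Local Set Implicit Arguments.
Local Unset Strict Implicit.
Context (K : numFieldType) (V : lmodType K).
Implicit Types (f g : V -> V -> V).

Definition bilinear_map f : Prop :=
  (forall (c : K) (x y z : V), f (c *: x + y) z = c *: f x z + f y z) /\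
  (forall (c : K) (x y z : V), f z (c *: x + y) = c *: f z x + f z y).

Lemma bilinear_flip f : bilinear_map f -> bilinear_map (fun x y => f y x).
Proof. by case. Qed.

Section Laws.
Context (f : V -> V -> V) (fB : bilinear_map f).

Lemma bil0l z : f 0 z = 0.
Proof. by have := fB.1 (-1) 0 0 z; rewrite !scaleN1r oppr0 addr0 addNr. Qed.

Lemma bil0r z : f z 0 = 0.
Proof. by have := fB.2 (-1) 0 0 z; rewrite !scaleN1r oppr0 addr0 addNr. Qed.

Lemma bilZl c x z : f (c *: x) z = c *: f x z.
Proof. by have := fB.1 c x 0 z; rewrite bil0l !addr0. Qed.

Lemma bilZr c x z : f z (c *: x) = c *: f z x.
Proof. by have := fB.2 c x 0 z; rewrite bil0r !addr0. Qed.

Lemma bilDl x y z : f (x + y) z = f x z + f y z.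
Proof. by have := fB.1 1 x y z; rewrite !scale1r. Qed.

Lemma bilDr x y z : f z (x + y) = f z x + f z y.
Proof. by have := fB.2 1 x y z; rewrite !scale1r. Qed.

Lemma bil_suml (I : Type) (t : seq I) (F : I -> V) z :
  f (\sum_(i <- t) F i) z = \sum_(i <- t) f (F i) z.
Proof.
by elim: t => [|i t IH]; rewrite ?big_nil ?bil0l // !big_cons bilDl IH.
Qed.

Lemma bil_sumr (I : Type) (t : seq I) (F : I -> V) z :
  f z (\sum_(i <- t) F i) = \sum_(i <- t) f z (F i).
Proof.
by elim: t => [|i t IH]; rewrite ?big_nil ?bil0r // !big_cons bilDr IH.
Qed.
End Laws.

Lemma bilinear_comb c f g : bilinear_map f -> bilinear_map g ->
  bilinear_map (fun x y => c *: f x y + g x y).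
Proof.
move=> fB gB; split=> k x y z; rewrite ?(fB.1, gB.1) ?(fB.2, gB.2);
  by rewrite !scalerDr !scalerA (mulrC c) addrACA.
Qed.

Definition biderivation (br f : V -> V -> V) : Prop :=
  (forall x y z, f (br x y) z = br x (f y z) + br (f x z) y) /\
  (forall x y z, f x (br y z) = br (f x y) z + br y (f x z)).

Lemma biderivation_flip br f :
  biderivation br f -> biderivation br (fun x y => f y x).
Proof.
by case=> d1 d2; split=> x y z; [rewrite d2 addrC | rewrite d1 addrC].
Qed.

Lemma biderivation_comb c br f g : bilinear_map br ->
  biderivation br f -> biderivation br g ->
  biderivation br (fun x y => c *: f x y + g x y).
Proof.
move=> brB [f1 f2] [g1 g2]; split=> x y z.
  rewrite f1 g1 !(bilDl brB, bilDr brB) (bilZl brB) (bilZr brB) scalerDr.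
  by rewrite addrACA.
rewrite f2 g2 !(bilDl brB, bilDr brB) (bilZl brB) (bilZr brB) scalerDr.
by rewrite addrACA.
Qed.
End Bilinear.

(** * The Lie algebra on any vector space with basis [vb], coordinates [co] and multiplication table
    [sv_table] *)

Section SchrodingerVirasoro.
Local Set Implicit Arguments.
Local Unset Strict Implicit.
Context (K : numFieldType) (V : lmodType K).
Context (vb : SVbasis -> V) (co : SVbasis -> V -> K).
Context (V_ind : forall P : V -> Prop, P 0 ->
           (forall c b x, P x -> P (c *: vb b + x)) -> forall x, P x).
Context (co_lin : forall b c x y, co b (c *: x + y) = c * co b x + co b y).
Context (co_vb : forall a b, co a (vb b) = (b == a)%:R).
Context (co_inj : forall x y, (forall b, co b x = co b y) -> x = y).
(* [E] is the integer [2 eps]; [BY k] still stands for Y_(k + eps). *)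
Context (E : int).

Definition sv_table (a b : SVbasis) : V :=
  match a, b with
  | BL m, BL n => (m - n)%:~R *: vb (BL (m + n))
  | BL m, BY k => (m%:~R / 2 - (k%:~R + E%:~R / 2)) *: vb (BY (m + k))
  | BY k, BL m => - (m%:~R / 2 - (k%:~R + E%:~R / 2)) *: vb (BY (m + k))
  | BL m, BM n => (- n)%:~R *: vb (BM (m + n))
  | BM n, BL m => n%:~R *: vb (BM (m + n))
  | BY k1, BY k2 => (k1 - k2)%:~R *: vb (BM (k1 + k2 + E))
  | _, _ => 0
  end.

Context (br : V -> V -> V) (brB : bilinear_map br).
Context (br_vb : forall a b, br (vb a) (vb b) = sv_table a b).

Lemma coD b x y : co b (x + y) = co b x + co b y.
Proof. by have := co_lin b 1 x y; rewrite scale1r mul1r. Qed.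

Lemma co0 b : co b 0 = 0.
Proof.
by have := co_lin b (-1) 0 0; rewrite scaleN1r oppr0 addr0 mulN1r addNr.
Qed.

Lemma coZ b c x : co b (c *: x) = c * co b x.
Proof. by have := co_lin b c x 0; rewrite co0 !addr0. Qed.

Lemma bilinear_map_ext (f g : V -> V -> V) : bilinear_map f -> bilinear_map g ->
  (forall a b, f (vb a) (vb b) = g (vb a) (vb b)) -> forall x y, f x y = g x y.
Proof.
move=> fB gB fg x y; elim/V_ind: x => [|c a x IHx]; first by rewrite !bil0l.
rewrite fB.1 gB.1 IHx; congr (_ *: _ + _).
elim/V_ind: y {IHx} => [|k b y IHy]; first by rewrite !bil0r.
by rewrite fB.2 gB.2 IHy fg.
Qed.

Lemma table_anti a b : sv_table a b = - sv_table b a.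
Proof.
case: a => i; case: b => j /=; rewrite ?oppr0 // -scaleNr ?opprK //.
- by rewrite -intrN opprB (addrC j).
- by rewrite intrN.
- by rewrite -intrN opprB (addrC j).
- by rewrite -intrN opprK.
Qed.

Lemma br_anti x y : br x y = - br y x.
Proof.
(* The zero multiple of [br x y] only brings the opposite bracket into the form that [bilinear_comb]
   treats. *)
have brB' : bilinear_map (fun x y => -1 *: br y x + 0 *: br x y).
  apply: bilinear_comb; first exact: bilinear_flip.
  by split=> c u v w; rewrite !scale0r scaler0 addr0.
rewrite -scaleN1r -[RHS]addr0 -(scale0r (br x y)).
apply: (bilinear_map_ext brB brB') => a b.
by rewrite scale0r addr0 scaleN1r !br_vb table_anti.
Qed.

(** Both sides are trilinear, so basis triples suffice. *)
Lemma derivation_basis (f : V -> V -> V) : bilinear_map f ->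
  (forall a b c, f (br (vb a) (vb b)) (vb c) =
     br (vb a) (f (vb b) (vb c)) + br (f (vb a) (vb c)) (vb b)) ->
  forall x y z, f (br x y) z = br x (f y z) + br (f x z) y.
Proof.
move=> fB fE x y z.
elim/V_ind: x => [|k a x IHx].
  by rewrite !(bil0l brB, bil0l fB) addr0.
rewrite !(brB.1, fB.1) IHx [RHS]addrACA -scalerDr; congr (_ *: _ + _).
elim/V_ind: y {x IHx} => [|k' b y IHy].
  by rewrite !(bil0r brB, bil0l fB) addr0.
rewrite brB.2 !fB.1 !brB.2 IHy [RHS]addrACA -scalerDr; congr (_ *: _ + _).
elim/V_ind: z {y IHy} => [|k'' c z IHz].
  by rewrite !(bil0r fB) (bil0r brB) (bil0l brB) addr0.
by rewrite !fB.2 brB.1 brB.2 IHz fE scalerDr addrACA.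
Qed.

(** Turns an identity between multiples of one basis vector, with indices equal only up to
    rearrangement, into an identity of coefficients. *)
Lemma scale_comb (X : int -> V) (a b c : K) (i j k : int) :
  a = b + c -> i = j -> i = k -> a *: X i = b *: X j + c *: X k.
Proof. by move=> -> <- <-; rewrite scalerDl. Qed.

(** The Jacobi identity in Leibniz form, which is the first biderivation identity for the bracket
    itself. *)
Lemma sv_Jacobi x y z : br (br x y) z = br x (br y z) + br (br x z) y.
Proof.
apply: derivation_basis => // a b c; rewrite !br_vb.
case: a => i; case: b => j; case: c => k /=;
  rewrite ?(bilZl brB, bilZr brB, bil0l brB, bil0r brB) ?br_vb /=;
  rewrite ?scaler0 ?addr0 // ?scalerA.
all: first [apply: (@scale_comb (fun i => vb (BL i)))
  | apply: (@scale_comb (fun i => vb (BY i)))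
  | apply: (@scale_comb (fun i => vb (BM i)))]; first [by ring | by field].
Qed.

Lemma biderivation_br : biderivation br br.
Proof.
split=> x y z; first exact: sv_Jacobi.
by rewrite sv_Jacobi (br_anti (br x z) y) subrK.
Qed.

(** * The action of the L_m on basis vectors and on coordinates *)

Definition shift (m : int) (b : SVbasis) : SVbasis :=
  match b with BL n => BL (m + n) | BY n => BY (m + n) | BM n => BM (m + n) end.
(** The coefficient of m in [L_m, vb b] = (wt b m - deg b) vb (shift m b). Each of the three
    families is a tensor density module over the Witt algebra, with this number as parameter. *)
Definition wt (b : SVbasis) : K :=
  match b with BL _ => 1 | BY _ => 2^-1 | BM _ => 0 end.
Definition deg (b : SVbasis) : K :=
  match b with BL n => n%:~R | BY n => n%:~R + E%:~R / 2 | BM n => n%:~R end.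

Lemma shift0 b : shift 0 b = b.
Proof. by case: b => n; rewrite /= add0r. Qed.

Lemma shiftD m n b : shift (m + n) b = shift m (shift n b).
Proof. by case: b => k; rewrite /= addrA. Qed.

Lemma shiftNK m : cancel (shift (- m)) (shift m).
Proof. by move=> b; rewrite -shiftD subrr shift0. Qed.

Lemma shiftK m : cancel (shift m) (shift (- m)).
Proof. by move=> b; rewrite -shiftD addNr shift0. Qed.

Lemma wt_shift m b : wt (shift m b) = wt b.
Proof. by case: b. Qed.

Lemma deg_shift m b : deg (shift m b) = m%:~R + deg b.
Proof. by case: b => n; rewrite /= intrD ?addrA. Qed.

Local Notation L m := (vb (BL m)).

Lemma br_L_vb m b : br (L m) (vb b) = (wt b * m%:~R - deg b) *: vb (shift m b).
Proof.
rewrite br_vb; case: b => n /=; congr (_ *: _).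
- by rewrite mul1r intrB.
- by rewrite mulrC.
- by rewrite mul0r add0r intrN.
Qed.

(** Since [shift m] is injective, only the coordinate of v at c can contribute. *)
Lemma co_br_L_shift m v c :
  co (shift m c) (br (L m) v) = (wt c * m%:~R - deg c) * co c v.
Proof.
elim/V_ind: v => [|k b v IHv]; first by rewrite bil0r // !co0 mulr0.
rewrite brB.2 !co_lin IHv br_L_vb coZ !co_vb (can_eq (shiftK m)).
by case: eqP => [->|_]; rewrite ?mulr1 ?mulr0 ?mulr0n; ring.
Qed.

Lemma co_br_L m v c :
  co c (br (L m) v) = (wt c * m%:~R + m%:~R - deg c) * co (shift (- m) c) v.
Proof.
rewrite -{1}(shiftNK m c) co_br_L_shift wt_shift deg_shift intrN.
by congr (_ * _); ring.
Qed.

(** * The values of a biderivation on pairs of L's *)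

Lemma biderivation_LL_cocycle f c : bilinear_map f -> biderivation br f ->
  witt_cocycle (wt c) (deg c) (fun p q => co (shift (p + q) c) (f (L p) (L q))).
Proof.
move=> fB fD m p n.
have := fD.1 (L m) (L p) (L n); rewrite br_L_vb bilZl //= mul1r.
rewrite (br_anti _ (L p)) -scaleN1r => /(congr1 (co (shift (m + p + n) c))).
rewrite coZ coD coZ !co_br_L -!shiftD !wt_shift !deg_shift.
rewrite (_ : - m + (m + p + n) = p + n); last by ring.
rewrite (_ : - p + (m + p + n) = m + n); last by ring.
by rewrite !intrD => ->; ring.
Qed.

(** Each coordinate function is a cocycle in both arguments, the second one by flipping f. The
    cocycle lemmas then apply according to the weight and to whether the degree is zero. *)
Lemma biderivation_LL f : bilinear_map f -> biderivation br f ->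
  forall p q c,
  co (shift (p + q) c) (f (L p) (L q)) =
  match c with
  | BL d => if d == 0 then (p%:~R - q%:~R) * co (BL 1) (f (L 1) (L 0)) else 0
  | BY _ => 0
  | BM d => co (BM d) (f (L 0) (L 0))
  end.
Proof.
move=> fB fD p q c.
have H := biderivation_LL_cocycle c fB fD.
have H' : witt_cocycle (wt c) (deg c) (fun q p => co (shift (p + q) c) (f (L p) (L q))).
  have := biderivation_LL_cocycle c (bilinear_flip fB) (biderivation_flip fD).
  by move=> H0 m k n; rewrite (addrC n) (addrC n) (addrC n); apply: H0.
case: c H H' => d H H'.
- have [d0|d0] := eqVneq d 0.
    rewrite d0 /= in H H' *.
    by rewrite (witt_bicocycle_one p q H H') addr0.
  apply: (witt_bicocycle_vanish (r := d) p q _ _ _ H H') => /=.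
  + exact: ltr01.
  + by rewrite mul1r.
  + by rewrite intr_eq0.
(* Degree zero, that is Y_0, lies outside [witt_bicocycle_vanish] and has its own lemma. *)
- have [d0|d0] := eqVneq (deg (BY d)) 0.
    by rewrite d0 in H H'; apply: (witt_bicocycle_half p q H H').
  (* Here s = 1/2, so [r] is twice the degree d + E/2, an integer. *)
  apply: (witt_bicocycle_vanish (r := 2 * d + E) p q _ _ d0 H H') => /=.
  + by rewrite invr_gt0 ltr0n.
  + by rewrite intrD intrM; field.
- rewrite (witt_bicocycle_const (h := fun p q => co _ (f (L p) (L q))) p q H H').
  by rewrite shift0.
Qed.

Lemma eigen_support v c d : br (L 0) v = - d *: v -> deg c != d -> co c v = 0.
Proof.
move=> /(congr1 (co c)); rewrite co_br_L oppr0 shift0 coZ mulr0z mulr0 !add0r.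
move=> H ne; have nz : deg c - d != 0 by rewrite subr_eq0.
by apply: (mulfI nz); apply: (lincomb (cmul (-1) H)); ring.
Qed.

Lemma br_L0_vb b : br (L 0) (vb b) = - deg b *: vb b.
Proof. by rewrite br_L_vb shift0 mulr0z mulr0 add0r. Qed.

(** * Biderivations vanishing on pairs of L's are zero *)

Section Vanishing.
Context (g : V -> V -> V) (gB : bilinear_map g) (gD : biderivation br g).

(** Taking L_0 as an entry of the second identity shows that [g x (vb b)] is homogeneous of the
    degree of b, because the other term contains [g x (L 0)]. *)
Lemma eigen_r x b : g x (L 0) = 0 ->
  br (L 0) (g x (vb b)) = - deg b *: g x (vb b).
Proof.
move=> g0; have := gD.2 x (L 0) (vb b).
by rewrite g0 bil0l // add0r br_L0_vb bilZr.
Qed.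

(* With m + p = n and m, p <> 0, the bracket terms in the expansion of
   g([L_m, L_p], x) have degrees shifted by m and p, hence cannot contribute. *)
Lemma biderivation_L_vb (gLL : forall p q, g (L p) (L q) = 0) n a :
  g (L n) (vb a) = 0.
Proof.
apply: co_inj => c; rewrite co0.
have supp k c' : deg c' != deg a -> co c' (g (L k) (vb a)) = 0.
  by apply: eigen_support; apply: eigen_r.
have [dc|] := eqVneq (deg c) (deg a); last exact: supp.
(* This choice makes m positive and p negative, hence also m - p nonzero. *)
pose m : int := `|n|%:Z + 1; pose p := n - m.
have m0 : m != 0 by rewrite /m; lia.
have p0 : p != 0 by rewrite /p /m; lia.
have mp : m - p != 0 by rewrite /p /m; lia.
have sh k : k != 0 -> deg (shift (- k) c) != deg a.
  move=> k0; rewrite deg_shift dc -subr_eq0 addrK intr_eq0 oppr_eq0 //.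
have := gD.1 (L m) (L p) (vb a).
rewrite br_vb /= (bilZl gB) (_ : m + p = n); last by rewrite /p; ring.
rewrite (br_anti _ (L p)) -scaleN1r => /(congr1 (co c)).
rewrite coD !coZ !co_br_L (supp p _ (sh m m0)) (supp m _ (sh p p0)) !mulr0 addr0 => /eqP.
by rewrite mulf_eq0 intr_eq0 (negPf mp) => /eqP.
Qed.

End Vanishing.

Lemma biderivation_vanish g : bilinear_map g -> biderivation br g ->
  (forall p q, g (L p) (L q) = 0) -> forall x y, g x y = 0.
Proof.
move=> gB gD gLL.
have gBf := bilinear_flip gB; have gDf := biderivation_flip gD.
have gL n a := biderivation_L_vb gB gD gLL n a.
have gR n a : g (vb a) (L n) = 0.
  by apply: (biderivation_L_vb gBf gDf) => p q; apply: gLL.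
have g0 a b : deg a != deg b -> g (vb a) (vb b) = 0.
  move=> ab; apply: co_inj => c; rewrite co0.
  have [ca|ca] := eqVneq (deg c) (deg a).
    apply: (@eigen_support _ _ (deg b)); last by rewrite ca.
    exact: (eigen_r gB gD).
  apply: (@eigen_support _ _ (deg a)) => //.
  by apply: (eigen_r gBf gDf (x := vb b)).
have zB : bilinear_map (fun _ _ : V => 0 : V).
  by split=> *; rewrite scaler0 addr0.
apply: (bilinear_map_ext gB zB) => a b.
have [ab|] := eqVneq (deg a) (deg b); last exact: g0.
(* vb b is a nonzero multiple of [L_m, vb (shift (- m) b)] for m = 1 or m = -1. *)
have key m : m != 0 -> wt b * m%:~R + m%:~R - deg b != 0 -> g (vb a) (vb b) = 0.
  move=> m0 nz; have := gD.2 (vb a) (L m) (vb (shift (- m) b)).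
  rewrite gR bil0l // g0; last first.
    by rewrite deg_shift ab -subr_eq0 opprD addrCA subrr addr0 oppr_eq0 intr_eq0 oppr_eq0.
  rewrite bil0r // addr0 br_L_vb wt_shift deg_shift shiftNK bilZr // intrN.
  move=> /eqP; rewrite scaler_eq0 => /orP[/eqP z|/eqP //].
  by case/negP: nz; apply/eqP; apply: (lincomb z); ring.
have wt0 : 0 <= wt b by case: (b) => ? /=; rewrite ?invr_ge0 ?ler01 ?ler0n.
(* The coefficients for m = 1 and m = -1 cannot both vanish: if the first does, the second equals -2
   (wt b + 1), which is nonzero since weights are nonnegative. *)
have [z|] := eqVneq (wt b * 1%:~R + 1%:~R - deg b) 0; last exact: key.
apply: (key (-1)) => //.
rewrite (_ : _ - _ = - (2 * (wt b + 1))); last by apply: (lincomb z); ring.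
by rewrite oppr_eq0 mulf_neq0 ?pnatr_eq0 // gt_eqF // ltr_wpDl.
Qed.

(** * The maps chi and the decomposition of a biderivation *)

Section Chi.
Context (s : seq int) (mu : int -> K) (chi : V -> V -> V) (chiB : bilinear_map chi).
Context (chi_vb : forall a b, chi (vb a) (vb b) =
  match a, b with
  | BL m, BL n => \sum_(i <- s) mu i *: vb (BM (m + n + i))
  | _, _ => 0
  end).

(** On L's the value depends only on m + n. Symmetry lets the second biderivation identity follow
    from the first. *)
Lemma chi_sym x y : chi x y = chi y x.
Proof.
apply: (bilinear_map_ext chiB (bilinear_flip chiB)) => a b.
by rewrite !chi_vb; case: a b => m [] n //; rewrite (addrC m).
Qed.

(** On three L's the coefficients agree because m - p = -(p + n + i) + (m + n + i); in the other
    cases every term is zero, since the M's commute with all Y's and M's. *)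
Lemma biderivation_chi : biderivation br chi.
Proof.
have D x y z : chi (br x y) z = br x (chi y z) + br (chi x z) y.
  apply: derivation_basis => // a b c; rewrite br_vb !chi_vb.
  case: a => m; case: b => p; case: c => n /=;
    rewrite ?(bilZl chiB) ?(bil0l chiB) ?chi_vb /= ?scaler0;
    rewrite ?(bil0l brB) ?(bil0r brB) ?addr0 ?add0r //.
  - rewrite (bil_sumr brB) (bil_suml brB) scaler_sumr -big_split /=.
    apply: eq_bigr => i _; rewrite (bilZl brB) (bilZr brB) !br_vb /= !scalerA.
    apply: (@scale_comb (fun i => vb (BM i))); by ring.
  - by rewrite (bil_suml brB) big1 // => i _; rewrite (bilZl brB) br_vb scaler0.
  - by rewrite (bil_suml brB) big1 // => i _; rewrite (bilZl brB) br_vb scaler0.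
  - by rewrite (bil_sumr brB) big1 // => i _; rewrite (bilZr brB) br_vb scaler0.
  - by rewrite (bil_sumr brB) big1 // => i _; rewrite (bilZr brB) br_vb scaler0.
split=> // x y z.
by rewrite chi_sym D (chi_sym z) (chi_sym y) addrC.
Qed.

Lemma biderivation_br_chi l : biderivation br (fun x y => l *: br x y + chi x y).
Proof.
exact: (biderivation_comb _ brB biderivation_br biderivation_chi).
Qed.

Context (s_uniq : uniq s) (mu_supp : forall i, i \notin s -> mu i = 0).

Lemma co_chi_LL m n c : co (shift (m + n) c) (chi (L m) (L n)) =
  if c is BM d then mu d else 0.
Proof.
have co_sum b : co b (\sum_(i <- s) mu i *: vb (BM (m + n + i)))
    = \sum_(i <- s) mu i * (BM (m + n + i) == b)%:R.
  elim: (s) => [|i t IH]; first by rewrite !big_nil co0.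
  by rewrite !big_cons coD coZ co_vb IH.
rewrite chi_vb co_sum; case: c => d /=.
- by rewrite big1 // => i _; rewrite mulr0.
- by rewrite big1 // => i _; rewrite mulr0.
have E1 i : (BM (m + n + i) == BM (m + n + d)) = (i == d).
  by apply/eqP/eqP => [[/addrI]|->].
have [ds|ds] := boolP (d \in s).
  rewrite (bigD1_seq d) //= E1 eqxx mulr1 big1 ?addr0 // => i id.
  by rewrite E1 (negPf id) mulr0.
rewrite (mu_supp ds) big1_seq // => i /= si; rewrite E1.
by rewrite (negPf (contraNneq _ ds)) ?mulr0 // => <-.
Qed.

Lemma co_br_LL m n c : co (shift (m + n) c) (br (L m) (L n)) =
  if c is BL d then if d == 0 then m%:~R - n%:~R else 0 else 0.
Proof.
rewrite br_vb /= coZ co_vb; case: c => d /=.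
- rewrite (_ : (_ == _) = (d == 0)).
    by case: eqP; rewrite ?mulr0 // mulr1 intrB.
  by apply/eqP/eqP => [[/eqP]|->]; rewrite ?addr0 // -subr_eq0 opprD addrA subrr add0r oppr_eq0 => /eqP.
- by rewrite mulr0.
- by rewrite mulr0.
Qed.

(** As [L_1, L_0] = L_1 while chi takes values in the M's, lambda must be the L_1-coordinate of
    f(L_1, L_0), and the mu_d are the M_d-coordinates of f(L_0, L_0). By [biderivation_LL] the
    difference then vanishes on all pairs of L's, hence everywhere. *)
Lemma biderivation_decomposition f : bilinear_map f -> biderivation br f ->
  (forall d, mu d = co (BM d) (f (L 0) (L 0))) ->
  forall x y, f x y = co (BL 1) (f (L 1) (L 0)) *: br x y + chi x y.
Proof.
move=> fB fD mu_f; set l := co _ _.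
pose f0 x y := l *: br x y + chi x y.
have f0B : bilinear_map f0 by exact: bilinear_comb.
have gB := bilinear_comb (-1) f0B fB.
have gD := biderivation_comb (-1) brB (biderivation_br_chi l) fD.
have g0 p q : -1 *: f0 (L p) (L q) + f (L p) (L q) = 0.
  apply: co_inj => c; rewrite co0 -(shiftNK (p + q) c).
  rewrite coD !coZ coD coZ (biderivation_LL fB fD) co_br_LL co_chi_LL.
  case: (shift _ c) => d; rewrite /= ?mu_f; last by ring.
    by rewrite -/l; case: eqP => _; ring.
  by ring.
move=> x y; have /eqP := biderivation_vanish gB gD g0 x y.
by rewrite scaleN1r addrC subr_eq0 => /eqP.
Qed.
End Chi.
End SchrodingerVirasoro.

(** * Linear and bilinear extension in the free module on the basis *)

Lemma SV_ind (P : SV -> Prop) :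
  P 0 -> (forall c b x, P x -> P (c *: << b >> + x)) -> forall x, P x.
Proof.
move=> P0 PS x; rewrite (monalgE x).
elim: (enum_fset (msupp x)) => [|b s IH]; first by rewrite big_nil.
rewrite big_cons (_ : << x@_b *g b >> = x@_b *: << b >>); first exact: PS.
by apply/malgP => k; rewrite mcoeffZ !mcoeffU mulrnAr mulr1.
Qed.

(** One-variable extension; [bilin_ext] is two of these nested, so its bilinearity reduces to
    linearity here. *)
Definition lin_ext (u : SVbasis -> SV) (x : SV) : SV :=
  \sum_(a <- msupp x) x@_a *: u a.

(** Allows sums over different supports to be compared over one common finite set. *)
Lemma lin_extEw u (x : SV) (d : {fset SVbasis}) : (msupp x `<=` d)%fset ->
  lin_ext u x = \sum_(a <- d) x@_a *: u a.
Proof.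
move=> le; apply: big_fset_incl => // a _ ha.
by rewrite (mcoeff_outdom ha) scale0r.
Qed.

Lemma lin_ext_linear u c x y : lin_ext u (c *: x + y) = c *: lin_ext u x + lin_ext u y.
Proof.
pose d := (msupp x `|` msupp y `|` msupp (c *: x + y))%fset.
have hx : (msupp x `<=` d)%fset by rewrite /d -fsetUA fsubsetUl.
have hy : (msupp y `<=` d)%fset by rewrite /d fsetUAC fsubsetUr.
have hz : (msupp (c *: x + y) `<=` d)%fset by rewrite /d fsubsetUr.
rewrite (lin_extEw u _ _ hx) (lin_extEw u _ _ hy) (lin_extEw u _ _ hz).
rewrite scaler_sumr -big_split; apply: eq_bigr => a _ /=.
by rewrite mcoeffD mcoeffZ scalerDl scalerA.
Qed.

Lemma lin_extU u b : lin_ext u << b >> = u b.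
Proof.
rewrite /lin_ext msuppU oner_eq0 big_seq_fset1.
by rewrite mcoeffUU scale1r.
Qed.

Lemma bilin_extE g x y : bilin_ext g x y = lin_ext (fun a => lin_ext (g a) y) x.
Proof.
apply: eq_bigr => a _; rewrite scaler_sumr.
by apply: eq_bigr => b _; rewrite scalerA.
Qed.

Lemma bilin_ext_bilinear g : is_bilinear (bilin_ext g).
Proof.
split=> c x y z; rewrite !bilin_extE; first exact: lin_ext_linear.
rewrite /lin_ext scaler_sumr -big_split; apply: eq_bigr => a _ /=.
by rewrite -/(lin_ext _ _) lin_ext_linear scalerDr !scalerA mulrC.
Qed.

Lemma bilin_extU g a b : bilin_ext g << a >> << b >> = g a b.
Proof. by rewrite bilin_extE !lin_extU. Qed.

Lemma SVbrE e a b : SVbr e a b = sv_table (V := SV) (fun b => << b >> : SV) (eps2 e) a b.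
Proof.
have epsE : epsC e = (eps2 e)%:~R / 2 by case: e; rewrite /= ?mul0r // div1r.
case: a => i; case: b => j; rewrite /SVbr /sv_table /cLY ?epsE; reflexivity.
Qed.

(** Supplies the family Omega: its finite support is inherited from v. *)
Lemma BM_coefficients (v : SV) : exists Om : {malg CC[int]}, forall d, Om@_d = v@_(BM d).
Proof.
elim/SV_ind: v => [|c b v [Om OmE]]; first by exists 0 => d; rewrite !mcoeff0.
case: b => n.
- by exists Om => d; rewrite OmE mcoeffD mcoeffZ mcoeffU mulr0 add0r.
- by exists Om => d; rewrite OmE mcoeffD mcoeffZ mcoeffU mulr0 add0r.
exists (c *: << n >> + Om) => d; rewrite !mcoeffD !mcoeffZ !mcoeffU OmE.
by rewrite (_ : (BM n == BM d) = (n == d)) //; apply/eqP/eqP => [[]|->].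
Qed.

(** * The concrete algebra as an instance of the coordinate setting *)

Section Instance.
Variable e : bool.
Let vb (b : SVbasis) : SV := << b >>.
Let co (b : SVbasis) (x : SV) : CC := x@_b.

Lemma co_lin b c x y : co b (c *: x + y) = c * co b x + co b y.
Proof. by rewrite /co mcoeffD mcoeffZ. Qed.

Lemma co_vb a b : co a (vb b) = (b == a)%:R.
Proof. exact: mcoeffU. Qed.

Lemma co_inj x y : (forall b, co b x = co b y) -> x = y.
Proof. by move/malgP. Qed.

Lemma br_vb a b : SVbracket e (vb a) (vb b) = sv_table vb (eps2 e) a b.
Proof. by rewrite -SVbrE; apply: bilin_extU. Qed.

Lemma chi_vb Om a b : chi Om (vb a) (vb b) =
  match a, b with
  | BL m, BL n => \sum_(i <- msupp Om) Om@_i *: vb (BM (m + n + i))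
  | _, _ => 0
  end.
Proof. exact: bilin_extU. Qed.
End Instance.

Theorem theorem3p6 (e : bool) (f : SV -> SV -> SV) :
  is_bilinear f ->
  (is_biderivation e f <->
   exists (lambda : CC) (Om : {malg CC[int]}),
     forall x y : SV, f x y = lambda *: SVbracket e x y + chi Om x y).
Proof.
move=> fB; have brB := bilin_ext_bilinear (SVbr e).
split=> [fD|[l [Om fE]]].
  have [Om OmE] := BM_coefficients (f (vL 0) (vL 0)).
  exists (f (vL 1) (vL 0))@_(BL 1), Om.
  apply: (biderivation_decomposition SV_ind co_lin co_vb co_inj brB (br_vb e)
    (bilin_ext_bilinear _) (chi_vb Om) (fset_uniq _) _ fB fD OmE).
  exact: mcoeff_outdom.
have [D1 D2] := biderivation_br_chi SV_ind brB (br_vb e)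
  (bilin_ext_bilinear _) (chi_vb Om) l.
by split=> x y z; rewrite !fE; [apply: D1 | apply: D2].
Qed.
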